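(* Let $\langle\mathbf{A}_{\mathrm d},\mathbf{A},\iota\rangle$ be a distributively generated (generalized) additive quantale with multiplication and let $\mathbf{Q}$ be an $\mathbf{A}$-module. Then: (i) if a congruence $\theta$ on $\mathbf{Q}$ is structural, then so is the additive consequence relation $\vdash_\theta$; (ii) if a nucleus $\gamma$ on $\mathbf{Q}$ is structural, then so is $\vdash_\gamma$; (iii) if an additive consequence relation $\vdash$ on $\mathbf{Q}$ is structural, then so are the congruence $\theta_\vdash$ and the nucleus $\gamma_\vdash$.
   Context: Fix one of two parallel settings: plain (''joins'' = joins of arbitrary families) or generalized (''joins'' = joins of non-empty families). A (generalized) quantale is $\langle Q,\bigvee,+,\mathsf{0}\rangle$ with $Q$ a poset having all such joins, $\langle Q,+,\mathsf{0}\rangle$ a monoid with $+$ order-preserving and distributing over such joins on both sides. A (generalized) additive quantale with multiplication is a triple $\langle\mathbf{A}_{\mathrm d},\mathbf{A},\iota\rangle$: $\mathbf{A}_{\mathrm d}$ a monoid, $\mathbf{A}$ a (generalized) quantale with an additional monoid structure $\langle A,\cdot,\mathsf 1\rangle$, $\iota\colon\mathbf{A}_{\mathrm d}\to\mathbf{A}$ a monoid homomorphism, such that $(\bigvee_i a_i)\cdot b=\bigvee_i(a_i\cdot b)$, $(a+b)\cdot c=a\cdot c+b\cdot c$, $\mathsf0\cdot a=\mathsf0$, and for $d\in\mathbf{A}_{\mathrm d}$ left multiplication by $\iota(d)$ preserves joins, $+$ and $\mathsf0$. It is distributively generated if $\mathbf{A}$ is generated as a (generalized) quantale by $\iota[\mathbf{A}_{\mathrm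 d}]$. An $\mathbf{A}$-module is a (generalized) quantale $\mathbf{Q}$ with a map $\ast\colon A\times Q\to Q$, order-preserving in both coordinates, with $(a\cdot b)\ast x=a\ast(b\ast x)$, $\mathsf1\ast x=x$, $(a+b)\ast x=a\ast x+b\ast x$, $\mathsf0\ast x=\mathsf0$, $(\bigvee_i a_i)\ast x=\bigvee_i(a_i\ast x)$, and for $d\in\mathbf{A}_{\mathrm d}$ the map $x\mapsto\iota(d)\ast x$ preserves $+$, $\mathsf0$ and joins. A congruence on $\mathbf{Q}$ is an equivalence relation compatible with $+$ and (non-empty) joins; it is structural if $\langle x,y\rangle\in\theta$ implies $\langle a\ast x,a\ast y\rangle\in\theta$ for all $a\in A$. An additive consequence relation is a relation $\vdash$ on $Q$ with: $x\geq y\Rightarrow x\vdash y$; transitivity; $x\vdash\bigvee\{y:x\vdash y\}$; $x\vdash y\Rightarrow x+z\vdash y+z$ and $z+x\vdash z+y$; it is structural if $x\vdash y$ implies $a\ast x\vdash a\ast y$ for all $a\in A$. A nucleus is an order-preserving, expansive, idempotent $\gamma\colon Q\to Q$ with $\gamma(x)+\gamma(y)\leq\gamma(x+y)$; it is structural if $a\ast\gamma(x)\leq\gamma(a\ast x)$ for all $a\in A$. Notation: $x\vdash_\theta y\iff\langle x\vee y,x\rangle\in\theta$; $x\vdash_\gamma y\iff y\leq\gamma(x)$; $\langle x,y\rangle\in\theta_\vdash\iff(x\vdash y$ and $y\vdash x)$; $\gamma_\vdash(x)=\bigvee\{y:x\vdash y\}$. *)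

(* Defs.v *)
From HB Require Import structures.
From mathcomp Require Import all_boot all_order.
From mathcomp Require Import boolp classical_sets.
From Stdlib Require Import RelationClasses.

Set Implicit Arguments.
Unset Strict Implicit.
Unset Printing Implicit Defensive.

Import Order.TTheory.
Local Open Scope classical_set_scope.
Local Open Scope order_scope.

(* The two parallel settings: joins of arbitrary families, or joins of
   non-empty families only. *)
Variant setting := Plain | Generalized.

Definition admissible (s : setting) (T : Type) (S : set T) : Prop :=
  match s with
  | Plain => True
  | Generalized => S !=set0
  end.

(* A (generalized) quantale; [qjoin] is a total function, but in the
   generalized setting its value on the empty set is unspecified. The monoid
   operation [qadd] is not assumed to be commutative. *)
HB.mixin Record isQuantale (s : setting) (d : Order.disp_t) Q
    of Order.POrder d Q := {
  qjoin : set Q -> Q;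
  qadd : Q -> Q -> Q;
  qzero : Q;
  qjoinP : forall S : set Q, admissible s S -> supremums S (qjoin S);
  qaddA : associative qadd;
  qadd0 : left_id qzero qadd;
  qaddr0 : right_id qzero qadd;
  qadd_le : forall x x' y y' : Q,
    x <= x' -> y <= y' -> qadd x y <= qadd x' y';
  qadd_joinl : forall (S : set Q) (y : Q), admissible s S ->
    qadd (qjoin S) y = qjoin [set qadd x y | x in S];
  qadd_joinr : forall (S : set Q) (y : Q), admissible s S ->
    qadd y (qjoin S) = qjoin [set qadd y x | x in S]
}.

#[short(type="quantaleType")]
HB.structure Definition Quantale (s : setting) (d : Order.disp_t) :=
  {Q of isQuantale s d Q & Order.POrder d Q}.

(* A (generalized) quantale with an additional monoid structure, written
   [x * y] and [1] in [group_scope]; the two structures are a priori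
   unrelated. *)
#[short(type="monoidQuantaleType")]
HB.structure Definition MonoidQuantale (s : setting) (d : Order.disp_t) :=
  {A of Quantale s d A & monoid.Monoid A}.

Declare Scope quantale_scope.
Delimit Scope quantale_scope with Q.
Notation "x + y" := (qadd x y) : quantale_scope.
Notation "0" := qzero : quantale_scope.
Notation "x \vee y" := (qjoin [set x; y])
  (at level 50, left associativity) : quantale_scope.
Local Open Scope quantale_scope.

(* [f] preserves [+], [0] and all joins of the setting. *)
Record quantale_morphism (s : setting) (d d' : Order.disp_t)
    (P : quantaleType s d) (Q : quantaleType s d') (f : P -> Q) : Prop := {
  qmorph_join : forall S : set P, admissible s S ->
    f (qjoin S) = qjoin (f @` S);
  qmorph_add : forall x y : P, f (x + y) = f x + f y;
  qmorph_zero : f 0 = 0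
}.

Record subquantale (s : setting) (d : Order.disp_t) (Q : quantaleType s d)
    (B : set Q) : Prop := {
  subq_join : forall S : set Q, admissible s S -> S `<=` B -> B (qjoin S);
  subq_add : forall x y : Q, B x -> B y -> B (x + y);
  subq_zero : B 0
}.

Record additive_quantale_with_multiplication (s : setting) (d : Order.disp_t)
    (Ad : monoidType) (A : monoidQuantaleType s d)
    (iota : UMagmaMorphism.type Ad A) : Prop := {
  aqm_joinl : forall (S : set A) (b : A), admissible s S ->
    (qjoin S * b)%g = qjoin [set (a * b)%g | a in S];
  aqm_addl : forall a b c : A, ((a + b) * c)%g = (a * c)%g + (b * c)%g;
  aqm_zerol : forall a : A, (0 * a)%g = 0 :> A;
  aqm_iota : forall e : Ad, quantale_morphism (fun a : A => (iota e * a)%g)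
}.

Definition distributively_generated (s : setting) (d : Order.disp_t)
    (Ad : monoidType) (A : monoidQuantaleType s d)
    (iota : UMagmaMorphism.type Ad A) : Prop :=
  forall B : set A, subquantale B -> range iota `<=` B -> B = [set: A].

Record aqm_module (s : setting) (d d' : Order.disp_t)
    (Ad : monoidType) (A : monoidQuantaleType s d)
    (iota : UMagmaMorphism.type Ad A)
    (Q : quantaleType s d') (act : A -> Q -> Q) : Prop := {
  act_le : forall (a b : A) (x y : Q), a <= b -> x <= y -> act a x <= act b y;
  act_mul : forall (a b : A) (x : Q), act (a * b)%g x = act a (act b x);
  act_one : forall x : Q, act 1%g x = x;
  act_add : forall (a b : A) (x : Q), act (a + b) x = act a x + act b x;
  act_zero : forall x : Q, act 0 x = 0;
  act_join : forall (S : set A) (x : Q), admissible s S ->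
    act (qjoin S) x = qjoin [set act a x | a in S];
  act_iota : forall e : Ad, quantale_morphism (act (iota e))
}.

Section Relations.
Variables (s : setting) (d : Order.disp_t) (Q : quantaleType s d).

Record congruence (theta : Q -> Q -> Prop) : Prop := {
  cong_equiv : Equivalence theta;
  cong_add : forall x x' y y' : Q,
    theta x x' -> theta y y' -> theta (x + y) (x' + y');
  cong_join : forall (I : Type) (x y : I -> Q), admissible s [set: I] ->
    (forall i, theta (x i) (y i)) -> theta (qjoin (range x)) (qjoin (range y))
}.

Record additive_consequence (vd : Q -> Q -> Prop) : Prop := {
  acr_ge : forall x y : Q, y <= x -> vd x y;
  acr_trans : forall x y z : Q, vd x y -> vd y z -> vd x z;
  acr_join : forall x : Q, vd x (qjoin [set y | vd x y]);
  acr_addr : forall x y z : Q, vd x y -> vd (x + z) (y + z);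
  acr_addl : forall x y z : Q, vd x y -> vd (z + x) (z + y)
}.

Record nucleus (gamma : Q -> Q) : Prop := {
  nuc_le : {homo gamma : x y / x <= y};
  nuc_expansive : forall x : Q, x <= gamma x;
  nuc_idem : forall x : Q, gamma (gamma x) = gamma x;
  nuc_add : forall x y : Q, gamma x + gamma y <= gamma (x + y)
}.

Definition cr_of_cong (theta : Q -> Q -> Prop) (x y : Q) : Prop :=
  theta (x \vee y) x.

Definition cr_of_nuc (gamma : Q -> Q) (x y : Q) : Prop := y <= gamma x.

Definition cong_of_cr (vd : Q -> Q -> Prop) (x y : Q) : Prop :=
  vd x y /\ vd y x.

Definition nuc_of_cr (vd : Q -> Q -> Prop) (x : Q) : Q :=
  qjoin [set y | vd x y].

Variables (A : Type) (act : A -> Q -> Q).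

(* For a congruence and for a consequence relation, being structural is the
   same closure condition on the underlying relation. *)
Definition structural_rel (r : Q -> Q -> Prop) : Prop :=
  forall (a : A) (x y : Q), r x y -> r (act a x) (act a y).

Definition structural_nuc (gamma : Q -> Q) : Prop :=
  forall (a : A) (x : Q), act a (gamma x) <= gamma (act a x).

End Relations.

(* Main.v *)
Require Import Defs.
From HB Require Import structures.
From mathcomp Require Import all_boot all_order.
From mathcomp Require Import boolp classical_sets.

(** The maps [act a] need not preserve joins, but congruence classes are
    convex: [x <= y <= z] and [theta z x] give
    [y = x \vee y] related to [z \vee y = z], hence to [x]. This is applied to
    [act a x <= act a x \vee act a y <= act a (x \vee y)]. The remaining
    arguments use that [x |- y] iff [y <= gamma x], where [gamma x] is the
    largest consequence of [x]; the latter is always an admissible join since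
    [x |- x]. *)

Set Implicit Arguments.
Unset Strict Implicit.
Unset Printing Implicit Defensive.

Import Order.TTheory.
Local Open Scope classical_set_scope.
Local Open Scope order_scope.
Local Open Scope quantale_scope.

(** * Admissibility, suprema and binary joins in both settings *)

Lemma admissible_nonempty (s : setting) (T : Type) (S : set T) :
  S !=set0 -> admissible s S.
Proof. by case: s. Qed.

Lemma admissible_image (s : setting) (T U : Type) (f : T -> U) (S : set T) :
  admissible s S -> admissible s (f @` S).
Proof. by case: s => // -[x Sx]; exists (f x); exists x. Qed.

Section Joins.
Variables (s : setting) (d : Order.disp_t) (Q : quantaleType s d).
Implicit Types (x y z : Q) (S : set Q).

(** The member [x] makes [S] non-empty, so [qjoin S] is a genuine supremum in either setting. *)
Lemma qjoin_ub S x : S x -> x <= qjoin S.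
Proof.
move=> Sx; have adS : admissible s S by apply: admissible_nonempty; exists x.
by case: (qjoinP _ adS) => ubS _; exact: ubS.
Qed.

Lemma qjoin_le S z : admissible s S -> (forall x, S x -> x <= z) ->
  qjoin S <= z.
Proof. by move=> /(qjoinP S)[_ least] ubz; apply: least => x; exact: ubz. Qed.

Lemma admissible_set2 x y : admissible s [set x; y].
Proof. by apply: admissible_nonempty; exists x; left. Qed.

Lemma qvee_ubl x y : x <= x \vee y.
Proof. by apply: qjoin_ub; left. Qed.

Lemma qvee_ubr x y : y <= x \vee y.
Proof. by apply: qjoin_ub; right. Qed.

Lemma qvee_le x y z : x <= z -> y <= z -> x \vee y <= z.
Proof.
by move=> xz yz; apply: qjoin_le (admissible_set2 x y) _ => _ [] ->.
Qed.

Lemma qvee_idPl x y : y <= x -> x \vee y = x.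
Proof. by move=> yx; apply: le_anti; rewrite qvee_ubl qvee_le. Qed.

Lemma qvee_idPr x y : x <= y -> x \vee y = y.
Proof. by move=> xy; apply: le_anti; rewrite qvee_ubr qvee_le. Qed.

Lemma qveeA x y z : x \vee (y \vee z) = x \vee y \vee z.
Proof.
apply: le_anti; apply/andP; split; do ?[apply: qvee_le].
- exact: le_trans (qvee_ubl _ _) (qvee_ubl _ _).
- exact: le_trans (qvee_ubr _ _) (qvee_ubl _ _).
- exact: qvee_ubr.
- exact: qvee_ubl.
- exact: le_trans (qvee_ubl _ _) (qvee_ubr _ _).
- exact: le_trans (qvee_ubr _ _) (qvee_ubr _ _).
Qed.

Lemma qadd_veel x y z : (x \vee y) + z = (x + z) \vee (y + z).
Proof.
by rewrite (qadd_joinl _ _ (admissible_set2 x y)) image_setU !image_set1.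
Qed.

Lemma qadd_veer x y z : z + (x \vee y) = (z + x) \vee (z + y).
Proof.
by rewrite (qadd_joinr _ _ (admissible_set2 x y)) image_setU !image_set1.
Qed.

(** * From congruences to consequence relations *)

Section CongruenceTheory.
Variables (theta : Q -> Q -> Prop) (thetaC : congruence theta).

Lemma cong_refl x : theta x x.
Proof. by case: (cong_equiv thetaC). Qed.

Lemma cong_sym x y : theta x y -> theta y x.
Proof. by case: (cong_equiv thetaC) => _ sym _; exact: sym. Qed.

Lemma cong_trans x y z : theta x y -> theta y z -> theta x z.
Proof. by case: (cong_equiv thetaC) => _ _; exact. Qed.

Lemma cong_vee x x' y y' :
  theta x x' -> theta y y' -> theta (x \vee y) (x' \vee y').
Proof.
move=> xx' yy'.
(* Congruences respect joins of indexed families; a binary join is the join of a family over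
   [bool]. *)
have range_bool u v : range (fun b : bool => if b then u else v) = [set u; v].
  apply/seteqP; split=> [_ [[] _ <-]|_ [] ->]; [by left | by right | |].
  - by exists true.
  - by exists false.
rewrite -!range_bool; apply: (cong_join thetaC) => [|[]//].
by apply: admissible_nonempty; exists true.
Qed.

Lemma cong_convex x y z : x <= y -> y <= z -> theta z x -> theta y x.
Proof.
move=> xy yz zx; have := cong_vee zx (cong_refl y).
rewrite (qvee_idPl yz) (qvee_idPr xy) => zy.
exact: cong_trans (cong_sym zy) zx.
Qed.

Lemma cr_of_congP : additive_consequence (cr_of_cong theta).
Proof.
have vd_ge x y : y <= x -> cr_of_cong theta x y.
  by move=> yx; rewrite /cr_of_cong qvee_idPl //; exact: cong_refl.
split=> //.
- move=> x y z xy yz; rewrite /cr_of_cong in xy yz *.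
  (* The triple join links both ends: absorbing [y] into [x] leaves [x \vee z], absorbing [z] into
     [y] leaves [x \vee y], which is related to [x]. *)
  have xz_xyz : theta (x \vee y \vee z) (x \vee z).
    exact: cong_vee xy (cong_refl z).
  have xyz_xy : theta (x \vee (y \vee z)) (x \vee y).
    exact: cong_vee (cong_refl x) yz.
  rewrite qveeA in xyz_xy; apply: cong_trans xy.
  exact: cong_trans (cong_sym xz_xyz) xyz_xy.
- move=> x; set C := [set y | cr_of_cong theta x y].
  have Cx : C x by exact: vd_ge.
  (* Over the consequences [y] of [x], the family of all [x \vee y] is termwise related to the
     constant family [x]. The index [i0], given by [x] itself, makes the family non-empty, so the
     constant one has join [x]. *)
  pose I := {y | C y}; pose i0 : I := exist _ x Cx.
  have adI : admissible s [set: I] by apply: admissible_nonempty; exists i0.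
  have := cong_join thetaC (x := fun i : I => x \vee sval i)
    (y := fun=> x) adI (fun i => svalP i).
  have -> : qjoin (range (fun _ : I => x)) = x.
    apply: le_anti; apply/andP; split; last by apply: qjoin_ub; exists i0.
    by apply: qjoin_le => [|_ [_ _ <-]//]; exact: admissible_image.
  (* [x \vee qjoin C] lies between [x] and the join of all [x \vee y]. *)
  apply: cong_convex; first exact: qvee_ubl.
  apply: qvee_le.
    apply: le_trans (qvee_ubl x (sval i0)) _.
    by apply: qjoin_ub; exists i0.
  apply: qjoin_le => [|y Cy]; first by apply: admissible_nonempty; exists x.
  apply: le_trans (qvee_ubr x y) _.
  by apply: qjoin_ub; exists (exist _ y Cy).
- move=> x y z xy; rewrite /cr_of_cong -qadd_veel.
  exact: (cong_add thetaC) xy (cong_refl z).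
- move=> x y z xy; rewrite /cr_of_cong -qadd_veer.
  exact: (cong_add thetaC) (cong_refl z) xy.
Qed.

Lemma structural_cr_of_cong (A : Type) (act : A -> Q -> Q) :
  (forall a, {homo act a : x y / x <= y}) ->
  structural_rel act theta -> structural_rel act (cr_of_cong theta).
Proof.
move=> act_homo stheta a x y /(stheta a); apply: cong_convex.
  exact: qvee_ubl.
by apply: qvee_le; apply: act_homo; [exact: qvee_ubl | exact: qvee_ubr].
Qed.

End CongruenceTheory.

(** * From nuclei to consequence relations *)

Section NucleusTheory.
Variables (gamma : Q -> Q) (gammaN : nucleus gamma).

Lemma cr_of_nucP : additive_consequence (cr_of_nuc gamma).
Proof.
have gamma_ge := nuc_expansive gammaN.
split; rewrite /cr_of_nuc.
- by move=> x y yx; exact: le_trans yx (gamma_ge x).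
- move=> x y z yx zy; apply: le_trans zy _.
  (* Monotonicity applied to [y <= gamma x] gives [gamma y <= gamma (gamma x)]. *)
  by rewrite -(nuc_idem gammaN x); exact: nuc_le.
- move=> x; apply: qjoin_le => //.
  by apply: admissible_nonempty; exists x; exact: gamma_ge.
(* Here [y + z <= gamma x + gamma z], by expansiveness at [z]. *)
- move=> x y z yx; apply: le_trans (nuc_add gammaN x z).
  exact: qadd_le.
- move=> x y z yx; apply: le_trans (nuc_add gammaN z x).
  exact: qadd_le.
Qed.

Lemma structural_cr_of_nuc (A : Type) (act : A -> Q -> Q) :
  (forall a, {homo act a : x y / x <= y}) ->
  structural_nuc act gamma -> structural_rel act (cr_of_nuc gamma).
Proof.
by move=> act_homo sgamma a x y xy; apply: le_trans (sgamma a x);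
  exact: act_homo.
Qed.

End NucleusTheory.

(** * From consequence relations to congruences and nuclei *)

Section ConsequenceTheory.
Variables (vd : Q -> Q -> Prop) (vdC : additive_consequence vd).

Lemma acr_refl x : vd x x.
Proof. exact: acr_ge. Qed.

Lemma acr_add x x' y y' : vd x x' -> vd y y' -> vd (x + y) (x' + y').
Proof.
move=> xx' yy'.
exact: (acr_trans vdC) (acr_addr vdC _ xx') (acr_addl vdC _ yy').
Qed.

(** [qjoin S] lies below the join of all consequences of [x], which is itself a consequence of
    [x]. *)
Lemma acr_qjoin x S : admissible s S -> (forall y, S y -> vd x y) ->
  vd x (qjoin S).
Proof.
move=> adS xS; apply: (acr_trans vdC (acr_join vdC x)); apply: (acr_ge vdC).
by apply: qjoin_le => // y Sy; apply: qjoin_ub; exact: xS.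
Qed.

Lemma cong_of_crP : congruence (cong_of_cr vd).
Proof.
split.
- split.
  + by move=> x; split; exact: acr_refl.
  + by move=> x y [].
  + by move=> x y z [xy yx] [yz zy]; split; apply: (acr_trans vdC); eassumption.
- by move=> x x' y y' [? ?] [? ?]; split; exact: acr_add.
- move=> I.
  (* By symmetry one direction suffices: the join of the [x i] entails each [x i], hence each [y i],
     hence their join. *)
  suff vd_join (x y : I -> Q) : admissible s [set: I] ->
      (forall i, vd (x i) (y i)) -> vd (qjoin (range x)) (qjoin (range y)).
    by move=> x y adI xy; split; apply: vd_join => // i; case: (xy i).
  move=> adI xy; apply: acr_qjoin => [|_ [i _ <-]].
    exact: admissible_image.
  apply: (acr_trans vdC) (xy i); apply: (acr_ge vdC).
  by apply: qjoin_ub; exists i.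
Qed.

Lemma structural_cong_of_cr (A : Type) (act : A -> Q -> Q) :
  structural_rel act vd -> structural_rel act (cong_of_cr vd).
Proof. by move=> svd a x y [xy yx]; split; exact: svd. Qed.

Lemma nuc_of_cr_le x z :
  (forall y, vd x y -> y <= z) -> nuc_of_cr vd x <= z.
Proof.
by apply: qjoin_le; apply: admissible_nonempty; exists x; exact: acr_refl.
Qed.

Lemma nuc_of_crP : nucleus (nuc_of_cr vd).
Proof.
have gamma_ub x y : vd x y -> y <= nuc_of_cr vd x by exact: qjoin_ub.
have gamma_ge x : x <= nuc_of_cr vd x by apply: gamma_ub; exact: acr_refl.
split=> //.
- move=> x y xy; apply: nuc_of_cr_le => z xz; apply: gamma_ub.
  exact: (acr_trans vdC) (acr_ge vdC xy) xz.
- move=> x; apply: le_anti; rewrite gamma_ge andbT.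
  (* Since [x] entails [nuc_of_cr vd x], every consequence of the latter is already one of [x]. *)
  apply: nuc_of_cr_le => z xz; apply: gamma_ub.
  exact: (acr_trans vdC) (acr_join vdC x) xz.
- by move=> x y; apply: gamma_ub; apply: acr_add; exact: acr_join.
Qed.

(** Acting by [a] on the entailment from [x] to its largest consequence makes
    [act a (nuc_of_cr vd x)] one of the consequences of [act a x] being joined. *)
Lemma structural_nuc_of_cr (A : Type) (act : A -> Q -> Q) :
  structural_rel act vd -> structural_nuc act (nuc_of_cr vd).
Proof. by move=> svd a x; apply: qjoin_ub; apply: svd; exact: acr_join. Qed.

End ConsequenceTheory.

End Joins.

Theorem theorem5p10 (s : setting) (d d' : Order.disp_t)
    (Ad : monoidType) (A : monoidQuantaleType s d)
    (iota : UMagmaMorphism.type Ad A)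
    (Q : quantaleType s d') (act : A -> Q -> Q)
    (hA : additive_quantale_with_multiplication iota)
    (hgen : distributively_generated iota)
    (hQ : aqm_module iota act) :
  (forall theta : Q -> Q -> Prop,
      congruence theta -> structural_rel act theta ->
      additive_consequence (cr_of_cong theta) /\
      structural_rel act (cr_of_cong theta))
  /\
  (forall gamma : Q -> Q,
      nucleus gamma -> structural_nuc act gamma ->
      additive_consequence (cr_of_nuc gamma) /\
      structural_rel act (cr_of_nuc gamma))
  /\
  (forall vd : Q -> Q -> Prop,
      additive_consequence vd -> structural_rel act vd ->
      (congruence (cong_of_cr vd) /\ structural_rel act (cong_of_cr vd)) /\
      (nucleus (nuc_of_cr vd) /\ structural_nuc act (nuc_of_cr vd))).
Proof.
have act_homo a : {homo act a : x y / x <= y}.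
  by move=> x y; exact: (act_le hQ (lexx a)).
split; [|split].
- move=> theta thetaC stheta; split; first exact: cr_of_congP.
  exact: structural_cr_of_cong.
- move=> gamma gammaN sgamma; split; first exact: cr_of_nucP.
  exact: structural_cr_of_nuc.
- move=> vd vdC svd; split; split.
  + exact: cong_of_crP.
  + exact: structural_cong_of_cr.
  + exact: nuc_of_crP.
  + exact: structural_nuc_of_cr.
Qed.
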